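(* Let $p,q\ge 1$ be integers and fix $0<c<1$. Let $m=cn$ and let $\pi$ be chosen uniformly at random from $\mathrm{PF}(m,n)$. Then, as $n\to\infty$, $$\mathbb E(\pi_1^p)=\frac{n^p}{p+1}\left(1+\frac1n\left(\frac{p+1}{2}-\frac{cp}{1-c}\right)+O\left(\frac1{n^2}\right)\right)$$ and $$\mathbb E(\pi_1^p\pi_2^q)=\frac{n^{p+q}}{(p+1)(q+1)}\left(1+\frac1n\left(\frac{p+q+2}{2}-\frac{c(p+q)}{1-c}\right)+O\left(\frac1{n^2}\right)\right).$$
   Context: Write $[n]=\{1,\dots,n\}$. For integers $0\le m\le n$, $\mathrm{PF}(m,n)$ denotes the set of parking functions with $m$ cars and $n$ spots: sequences $(\pi_1,\dots,\pi_m)\in[n]^m$ such that, when cars $1,\dots,m$ enter in order a one-way street with spots $1,\dots,n$ and car $i$ parks in spot $\pi_i$ if it is free and otherwise in the first free spot after $\pi_i$, all cars park. Equivalently, the non-decreasing rearrangement $(\lambda_1,\dots,\lambda_m)$ satisfies $\lambda_i\le n-m+i$ for all $i$. The limit $n\to\infty$ is along integers $n$ with $cn$ an integer; $c,p,q$ are fixed and the $O$-constants may depend on them. *)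

(* Defs.v *)
From HB Require Import structures.
From mathcomp Require Import all_boot all_order all_algebra.
Set Implicit Arguments.
Unset Strict Implicit.
Unset Printing Implicit Defensive.
Import GRing.Theory.
Local Open Scope ring_scope.

(* Free spots of the street 1, ..., n that a car preferring spot [a] meets, in
   driving order, when the spots in [occ] are taken. *)
Definition free_from (n : nat) (occ : seq nat) (a : nat) : seq nat :=
  [seq s <- iota a (n.+1 - a) | s \notin occ].

(* [parks n occ prefs]: cars with preferences [prefs] enter in this order while
   the spots in [occ] are already taken, and every one of them parks. *)
Fixpoint parks (n : nat) (occ prefs : seq nat) : bool :=
  if prefs is a :: prefs' then
    if free_from n occ a is s :: _ then parks n (s :: occ) prefs' else false
  else true.

(* Values in [n] = {1, ..., n} are encoded as nonzero elements of 'I_n.+1. *)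
Definition PF (m n : nat) : {set m.-tuple 'I_n.+1} :=
  [set pi : m.-tuple 'I_n.+1 |
     all (fun a : 'I_n.+1 => (0 < a)%N) pi
     && parks n [::] [seq nat_of_ord a | a <- pi]].

(* [car pi i] is the preference pi_i for 1 <= i <= m (cars numbered from 1);
   it is only meaningful in that range. *)
Definition car (m n : nat) (pi : m.-tuple 'I_n.+1) (i : nat) : nat :=
  nth ord0 pi i.-1.

(* Expectation of [f] under the uniform distribution on a nonempty set [A]. *)
Definition uniform_expectation (R : fieldType) (T : finType) (A : {set T})
    (f : T -> R) : R :=
  (\sum_(x in A) f x) / #|A|%:R.

(* Main.v *)
Require Import Defs.
From mathcomp Require Import all_boot all_order all_algebra.
From mathcomp Require Import all_classical all_reals all_analysis.
From mathcomp Require Import zify ring.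
Set Implicit Arguments.
Unset Strict Implicit.
Unset Printing Implicit Defensive.
Import Order.TTheory GRing.Theory Num.Theory.
Import numFieldNormedType.Exports.
Local Open Scope classical_set_scope.
Local Open Scope ring_scope.

(* A preference list is a parking function iff, for every k < n, at most n - k
   cars prefer a spot beyond k. The number of lists satisfying this is known
   exactly. Putting one more car in front with preference a spoils a good list
   of m cars only if, for some k < a, the spots beyond k are already full, and by
   a Chernoff bound this has probability O(r^(n - k)) with r = c e^(1 - c) < 1.
   Hence the preferences that are lost lie within O(1) of n, even in second
   moment; replacing a^p by n^p on them changes the p-th moment by a relative
   O(1 / n^2), and the number of lost preferences is given by the exact count.
   For two extra cars the losses caused by a and by b add up, except for pairs
   with both a and b within O(1) of n. *)

(** * Counting criterion for parking *)

Definition good (n : nat) (w : seq nat) : bool :=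
  all (fun k => count (ltn k) w <= n - k)%N (iota 0 n).

Lemma goodP (n : nat) (w : seq nat) :
  reflect (forall k, (k < n)%N -> (count (ltn k) w <= n - k)%N) (good n w).
Proof.
apply: (iffP allP) => H k; first by move=> kn; apply: H; rewrite mem_iota.
by rewrite mem_iota add0n => /andP[_ /H].
Qed.

(** Each of the k + 1 - i values from i to k occurs in s. A fully taken block of spots thus gives a
    lower bound on a count. *)
Lemma count_ltn_gap (s : seq nat) (i k : nat) : (i <= k)%N ->
  (forall x, (i <= x <= k)%N -> x \in s) ->
  (count (ltn k) s + (k.+1 - i) <= count (leq i) s)%N.
Proof.
move=> ik sub.
have -> : count (leq i) s = (count (ltn k) s + count (fun x => i <= x <= k)%N s)%N.
  elim: s {sub} => //= x s ->.
  have -> : (i <= x = (k < x) + (i <= x <= k) :> nat)%N.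
    by case: (leqP i x) => ix; case: (leqP x k) => xk //=; lia.
  by rewrite -!addnA; congr (_ + _)%N; rewrite addnCA.
rewrite leq_add2l -size_filter.
have -> : (k.+1 - i = size (iota i (k.+1 - i)))%N by rewrite size_iota.
apply: uniq_leq_size; first exact: iota_uniq.
move=> x; rewrite mem_iota mem_filter => xi.
have xik : (i <= x <= k)%N by lia.
by rewrite xik sub.
Qed.

(** Induction on the cars, a taken spot being treated as a preference for exactly that spot. A car
    preferring a and parking in s turns a into s; this preserves [good] because the spots from a to
    s - 1 are all taken. *)
Lemma parks_good (n : nat) (occ w : seq nat) :
  uniq occ -> all (fun x => 0 < x <= n)%N (occ ++ w) ->
  parks n occ w = good n (occ ++ w).
Proof.
elim: w occ => [|a w IH] occ uocc /=.
  (* Distinct taken spots beyond k lie among the n - k spots k + 1, ..., n. *)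
  rewrite cats0 => /allP occn; apply/esym/goodP => k kn.
  rewrite -size_filter -(size_iota k.+1 (n - k)).
  apply: uniq_leq_size; first exact: filter_uniq.
  move=> x; rewrite mem_filter mem_iota => /andP[/= kx /occn]; lia.
rewrite all_cat /= => /and3P[occn /andP[a0 an] wn].
case E: (free_from n occ a) => [|s l].
  (* If a, ..., n are all taken, these spots and the new car violate the condition at a - 1. *)
  apply/esym/negP => /goodP /(_ a.-1).
  have sub x : (a <= x <= n)%N -> x \in occ.
    move=> xa; apply: contraT => xocc.
    have : x \in free_from n occ a by rewrite mem_filter xocc mem_iota; lia.
    by rewrite E.
  have := count_ltn_gap an sub.
  rewrite count_cat /=.
  have -> : count (ltn a.-1) occ = count (leq a) occ.
    by apply: eq_count => x /=; lia.
  by lia.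
have [sa sn socc sub] : [/\ (a <= s)%N, (s <= n)%N, s \notin occ &
    forall x, (a <= x < s)%N -> x \in occ].
  have sin : s \in free_from n occ a by rewrite E mem_head.
  move: (sin); rewrite mem_filter mem_iota => /andP[-> sb].
  split; try lia; move=> x xs; apply: contraT => xocc.
  have : x \in free_from n occ a by rewrite mem_filter xocc mem_iota; lia.
  have : sorted ltn (free_from n occ a).
    by apply: sorted_filter; [exact: ltn_trans | exact: iota_ltn_sorted].
  rewrite E /= (path_sortedE ltn_trans) inE => /andP[/allP lts _].
  by case/predU1P => [|/lts /=]; lia.
rewrite IH; first last.
- by rewrite /= all_cat occn wn; lia.
- by rewrite /= socc.
apply/goodP/goodP => H k kn.
  have := H k kn; rewrite /= !count_cat /=.
  case: (ltnP k a) => ka; case: (ltnP k s) => ks; lia.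
have Hk := H k kn; move: Hk; rewrite /= !count_cat /=.
case: (ltnP k a) => ka; first by lia.
case: (ltnP k s) => ks; last by lia.
(* The case a <= k < s: the condition at a - 1, less the k + 1 - a taken spots a, ..., k, gives the
   condition at k with s counted. *)
move=> _; have := H a.-1; rewrite !count_cat /=.
have -> : count (ltn a.-1) occ = count (leq a) occ by apply: eq_count => x /=; lia.
have sub' x : (a <= x <= k)%N -> x \in occ by move=> xa; apply: sub; lia.
have := count_ltn_gap ka sub'.
have : (count (ltn k) w <= count (ltn a.-1) w)%N by apply: sub_count => x /=; lia.
by lia.
Qed.

(** * Sums over words of fixed length *)

Section WordSum.
Variable R : numDomainType.
Implicit Types (r : seq nat) (F G : seq nat -> R).

(** The recursion splits off the first letter, so that a new car in front is one unfolding of the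
    sum. *)
Fixpoint word_sum r (m : nat) F : R :=
  if m is m'.+1 then \sum_(a <- r) word_sum r m' (fun w => F (a :: w))
  else F [::].

Lemma eq_word_sum r m F G :
  (forall w, size w = m -> {subset w <= r} -> F w = G w) ->
  word_sum r m F = word_sum r m G.
Proof.
elim: m F G => [|m IH] F G FG /=; first exact: FG.
apply: eq_big_seq => a ar; apply: IH => w sw wr; apply: FG => /=; first by rewrite sw.
by move=> x; rewrite inE => /predU1P[->//|/wr].
Qed.

Lemma ler_word_sum r m F G :
  (forall w, F w <= G w) -> word_sum r m F <= word_sum r m G.
Proof.
elim: m F G => [|m IH] F G FG /=; first exact: FG.
by apply: ler_sum => a _; apply: IH.
Qed.

Lemma word_sumD r m F G :
  word_sum r m (fun w => F w + G w) = word_sum r m F + word_sum r m G.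
Proof.
elim: m F G => [|m IH] F G //=.
by rewrite -big_split /=; apply: eq_bigr => a _; rewrite IH.
Qed.

Lemma word_sumZ r m (x : R) F :
  word_sum r m (fun w => x * F w) = x * word_sum r m F.
Proof.
elim: m F => [|m IH] F //=.
by rewrite mulr_sumr; apply: eq_bigr => a _; rewrite IH.
Qed.

Lemma word_sumB r m F G :
  word_sum r m (fun w => F w - G w) = word_sum r m F - word_sum r m G.
Proof.
rewrite -[- word_sum r m G]mulN1r -word_sumZ -word_sumD.
by apply: eq_word_sum => w _ _; rewrite mulN1r.
Qed.

Lemma word_sum_sum (I : Type) (s : seq I) (P : pred I) r m (F : I -> seq nat -> R) :
  word_sum r m (fun w => \sum_(i <- s | P i) F i w) =
  \sum_(i <- s | P i) word_sum r m (F i).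
Proof.
elim: m F => [|m IH] F //=.
by rewrite exchange_big /=; apply: eq_bigr => a _; rewrite IH.
Qed.

Lemma word_sum_map (h : nat -> nat) r m F :
  word_sum (map h r) m F = word_sum r m (fun w => F (map h w)).
Proof.
elim: m F => [|m IH] F //=.
by rewrite big_map; apply: eq_bigr => a _; rewrite IH.
Qed.

Lemma ler_norm_word_sum r m F : `|word_sum r m F| <= word_sum r m (fun w => `|F w|).
Proof.
elim: m F => [|m IH] F //=.
by apply: le_trans (ler_norm_sum _ _ _) _; apply: ler_sum.
Qed.

(** The letters are chosen independently, so the generating function of the count factors. It is the
    exponential moment of the Chernoff bound. *)
Lemma word_sum_expr_count r m (x : R) (P : pred nat) :
  word_sum r m (fun w => x ^+ count P w) = (\sum_(a <- r) x ^+ P a) ^+ m.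
Proof.
elim: m => [|m IH] //=.
rewrite exprS mulr_suml; apply: eq_bigr => a _.
by rewrite -IH -word_sumZ; apply: eq_word_sum => w _ _; rewrite exprD.
Qed.

(** Group the words by the j positions holding a nonzero letter; the induction on m is Pascal's
    rule. *)
Lemma word_sum_filter r m F : 0%N \notin r ->
  word_sum (0%N :: r) m (fun w => F [seq x <- w | (0 < x)%N]) =
  \sum_(j < m.+1) 'C(m, j)%:R * word_sum r j F.
Proof.
move=> r0; elim: m F => [|m IH] F /=; first by rewrite big_ord1 bin0 mul1r.
rewrite big_cons /= IH.
have -> : \sum_(a <- r) word_sum (0%N :: r) m
     (fun w => F (if (0 < a)%N then a :: [seq x <- w | (0 < x)%N]
                  else [seq x <- w | (0 < x)%N])) =
   \sum_(j < m.+1) 'C(m, j)%:R * word_sum r j.+1 F.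
  rewrite /=; under [RHS]eq_bigr do rewrite mulr_sumr.
  rewrite exchange_big /=; apply: eq_big_seq => a ar.
  have a0 : (0 < a)%N by rewrite lt0n; apply: contraNneq r0 => <-.
  by rewrite a0 -IH.
rewrite [RHS]big_ord_recl bin0 mul1r.
under [X in _ = _ + X]eq_bigr do rewrite lift0 binS natrD mulrDl.
rewrite big_split /= addrA; congr (_ + _).
rewrite big_ord_recl bin0 mul1r; congr (_ + _).
rewrite big_ord_recr /= bin_small // mul0r addr0.
by apply: eq_bigr.
Qed.

End WordSum.

(** * Exact number of good words *)

Lemma good_map_succ (n : nat) (v : seq nat) :
  good n.+1 (map S v) = (size v <= n.+1)%N && good n [seq x <- v | (0 < x)%N].
Proof.
have count0 : count (ltn 0) (map S v) = size v.
  by rewrite count_map; apply/eqP; rewrite -all_count; apply/allP.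
have countS k : count (ltn k.+1) (map S v) = count (ltn k) [seq x <- v | (0 < x)%N].
  rewrite count_map count_filter; apply: eq_count => x /=; lia.
(* Condition 0 is the length bound; condition k + 1 for the shifted word is condition k once the
   zeros are dropped. *)
apply/goodP/andP => [H|[sv /goodP H] [|k] kn].
- split; first by rewrite -count0 -(subn0 n.+1); apply: H.
  by apply/goodP => k kn; rewrite -countS -subSS; apply: H.
- by rewrite count0 subn0.
- by rewrite countS subSS; apply: H.
Qed.

Section Count.
Variable R : numFieldType.

Definition good_count (m n : nat) : R :=
  word_sum (iota 1 n) m (fun w => (good n w)%:R).

Lemma sum_binomial_expr (x : R) (m : nat) :
  \sum_(j < m.+1) 'C(m, j)%:R * x ^+ j = (1 + x) ^+ m.
Proof.
by rewrite exprDn; apply: eq_bigr => i _; rewrite expr1n mul1r mulr_natl.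
Qed.

(** The binomial theorem differentiated and multiplied by x; the factor 1 + x avoids the exponent m
    - 1. *)
Lemma sum_mul_binomial_expr (x : R) (m : nat) :
  (1 + x) * (\sum_(j < m.+1) 'C(m, j)%:R * (j%:R * x ^+ j)) =
  m%:R * x * (1 + x) ^+ m.
Proof.
case: m => [|m]; first by rewrite big_ord1 !mul0r !mulr0.
rewrite big_ord_recl !mul0r mulr0 add0r.
transitivity ((1 + x) * \sum_(j < m.+1) m.+1%:R * x * ('C(m, j)%:R * x ^+ j)).
  congr (_ * _); apply: eq_bigr => j _; rewrite lift0.
  rewrite mulrA -natrM mulnC -mul_bin_diag natrM exprS /=; ring.
by rewrite -mulr_sumr sum_binomial_expr exprS; ring.
Qed.

(* Removing the cars that prefer spot 1 and the spot itself leaves a parking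
   function on n - 1 spots, whence
   [good_count m n.+1 = \sum_j 'C(m, j) * good_count j n]. *)
Lemma good_countE (m n : nat) : (m <= n.+1)%N ->
  n.+1%:R * good_count m n = (n.+1%:R - m%:R) * n.+1%:R ^+ m.
Proof.
elim: n m => [|n IH] m mn.
  case: m mn => [|[|//]] _; rewrite /good_count /=; first by ring.
  by rewrite big_nil subrr mul0r mulr0.
(* With one car more than spots both sides vanish. The recursion below needs this boundary case, one
   level down, for j = n + 1. *)
have [mn2|] := leqP m n.+1; last first.
  move=> nm; have -> : m = n.+2 by lia.
  rewrite subrr mul0r /good_count (@eq_word_sum _ _ _ _ (fun=> 0 * 0)); last first.
    move=> w sw wr; rewrite mul0r; case: goodP => // /(_ 0%N isT).
    suff -> : count (ltn 0) w = size w by rewrite sw; lia.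
    apply/eqP; rewrite -all_count; apply/allP => x /wr; rewrite mem_iota /=; lia.
  by rewrite word_sumZ mul0r mulr0.
have rec : good_count m n.+1 = \sum_(j < m.+1) 'C(m, j)%:R * good_count j n.
  rewrite /good_count -word_sum_filter ?mem_iota //.
  rewrite (iotaDl 1 0 n.+1).
  rewrite word_sum_map; apply: eq_word_sum => w sw _.
  by rewrite good_map_succ sw mn2.
have n0 : n.+1%:R != 0 :> R by rewrite pnatr_eq0.
apply: (mulfI n0); rewrite mulrCA rec mulr_sumr.
(* The induction hypothesis turns each term into (n + 1 - j) (n + 1)^j, which leaves the two
   binomial sums at x = n + 1. *)
have -> : \sum_(j < m.+1) n.+1%:R * ('C(m, j)%:R * good_count j n) =
    n.+1%:R * (\sum_(j < m.+1) 'C(m, j)%:R * n.+1%:R ^+ j) -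
    \sum_(j < m.+1) 'C(m, j)%:R * (j%:R * n.+1%:R ^+ j).
  rewrite mulr_sumr -sumrB; apply: eq_bigr => j _.
  rewrite mulrCA IH; first by ring.
  by have := ltn_ord j; lia.
rewrite sum_binomial_expr -(natr1 n.+1) [_%:R + 1]addrC mulrBr sum_mul_binomial_expr.
ring.
Qed.

(** * Words spoiled by one or two extra cars *)

Lemma good_cons (n a : nat) (w : seq nat) : good n (a :: w) -> good n w.
Proof. by move=> /goodP H; apply/goodP => k /H /=; lia. Qed.

(** The slack of one lets the same event cover a violation caused by one extra car or by two. *)
Definition crowded (n k : nat) (w : seq nat) : bool :=
  (n - k <= (count (ltn k) w).+1)%N.

(** Union bound over the thresholds k. *)
Lemma bool_le_sum_crowded (n : nat) (P : pred nat) (b : bool) (w : seq nat) :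
  (b -> exists k, [/\ (k < n)%N, P k & crowded n k w]) ->
  b%:R <= \sum_(k < n) (P k)%:R * (crowded n k w)%:R :> R.
Proof.
case: b => [/(_ isT)[k [kn Pk ck]]|_]; last first.
  by apply: sumr_ge0 => k _; rewrite mulr_ge0.
rewrite (bigD1 (Ordinal kn)) //= Pk ck mulr1 lerDl.
by apply: sumr_ge0 => i _; rewrite mulr_ge0.
Qed.

Lemma good_cons_gap (n a : nat) (w : seq nat) :
  0 <= (good n w)%:R - (good n (a :: w))%:R :> R /\
  (good n w)%:R - (good n (a :: w))%:R <=
    \sum_(k < n) (k < a)%N%:R * (crowded n k w)%:R :> R.
Proof.
have E : (good n w)%:R - (good n (a :: w))%:R =
         (good n w && ~~ good n (a :: w))%:R :> R.
  case ga: (good n (a :: w)); first by rewrite (good_cons ga) subrr.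
  by case: (good n w); rewrite subr0.
rewrite E ler0n; split=> //; apply: (bool_le_sum_crowded (P := fun k => (k < a)%N)).
case/andP => /goodP gw /allPn[k]; rewrite mem_iota /= add0n => kn ck.
exists k; rewrite kn /crowded; have := gw k kn; split=> //; move: ck; lia.
Qed.

(** The second difference vanishes unless a and b both spoil w on their own, or neither does but the
    two together do. In either case some crowded threshold lies below both a and b. *)
Lemma good_cons2_gap (n a b : nat) (w : seq nat) :
  `|(good n (a :: b :: w))%:R - (good n (a :: w))%:R - (good n (b :: w))%:R
    + (good n w)%:R|
    <= \sum_(k < n) ((k < a) && (k < b))%N%:R * (crowded n k w)%:R :> R.
Proof.
have swap : good n (a :: b :: w) -> good n (a :: w).
  by move=> /goodP H; apply/goodP => k /H /=; lia.
pose B := [|| good n w && ~~ good n (a :: w) && ~~ good n (b :: w) |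
              good n (a :: w) && good n (b :: w) && ~~ good n (a :: b :: w)].
have E : `|(good n (a :: b :: w))%:R - (good n (a :: w))%:R - (good n (b :: w))%:R
    + (good n w)%:R| <= B%:R :> R.
  rewrite /B; case gab: (good n (a :: b :: w)).
    rewrite (swap gab) (good_cons gab) (good_cons (swap gab)) /=.
    by rewrite subrr sub0r addNr normr0.
  case ga: (good n (a :: w)).
    rewrite (good_cons ga); case: (good n (b :: w)) => /=.
      by rewrite sub0r addrAC addNr add0r normrN normr1.
    by rewrite sub0r subr0 addNr normr0.
  case gb: (good n (b :: w)).
    by rewrite (good_cons gb) subr0 sub0r addNr normr0 /=.
  by case: (good n w); rewrite !subr0 add0r ?normr1 ?normr0 /=.
apply: le_trans E _.
apply: (bool_le_sum_crowded (P := fun k => (k < a) && (k < b))%N).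
case/orP => /andP[/andP[/goodP H1]].
  move=> /allPn[k]; rewrite mem_iota /= => kn ck.
  move=> /allPn[l]; rewrite mem_iota /= => ln cl.
  (* The smaller of the two violated thresholds lies below both a and b. *)
  have [kl|lk] := leqP k l.
    exists k; split; [by lia | | ].
      by have := H1 _ kn; have := H1 _ ln; move: ck cl; lia.
    by rewrite /crowded; move: ck; lia.
  exists l; split; [by lia | | ].
    by have := H1 _ kn; have := H1 _ ln; move: ck cl; lia.
  by rewrite /crowded; move: cl; lia.
move=> /goodP H2 /allPn[k]; rewrite mem_iota /= => kn.
have := H1 k kn; have := H2 k kn; rewrite /crowded /= => c1 c2 c3.
by exists k; split; move: c1 c2 c3; lia.
Qed.

(** * Power sums by the trapezoidal rule *)

Lemma big_iota1 (V : nmodType) (n : nat) (F : nat -> V) :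
  \sum_(a <- iota 1 n) F a = \sum_(i < n) F i.+1.
Proof.
by rewrite (iotaDl 1 0 n) big_map -(big_mkord xpredT (fun i => F i.+1)) /index_iota subn0.
Qed.

Lemma sum_iota_threshold (n k : nat) (f : bool -> R) : (k <= n)%N ->
  \sum_(a <- iota 1 n) f (k < a)%N = k%:R * f false + (n%:R - k%:R) * f true.
Proof.
rewrite big_iota1; elim: n => [|n IH].
  by rewrite leqn0 => /eqP ->; rewrite big_ord0; ring.
rewrite leq_eqVlt => /predU1P[->|kn].
  rewrite (eq_bigr (fun=> f false)) => [|i _]; last first.
    by rewrite ltnNge ltn_ord.
  by rewrite sumr_const card_ord subrr mul0r addr0 mulr_natl.
rewrite big_ord_recr /= IH // kn -[in RHS]natr1; ring.
Qed.

(** Mean value bound; [N ^+ i / N] is written for the power i - 1 so that i = 0 is covered. *)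
Lemma subr_expr_le (x y N : R) (i : nat) : 0 <= x -> x <= y -> y <= N -> 0 < N ->
  0 <= y ^+ i - x ^+ i <= i%:R * N ^+ i / N * (y - x).
Proof.
move=> x0 xy yN N0; have y0 := le_trans x0 xy.
rewrite subr_ge0 lerXn2r ?nnegrE //=.
elim: i => [|i IH]; first by rewrite !expr0 subrr !mul0r.
have -> : y ^+ i.+1 - x ^+ i.+1 = y * (y ^+ i - x ^+ i) + x ^+ i * (y - x).
  by rewrite !exprS; ring.
have -> : i.+1%:R * N ^+ i.+1 / N * (y - x) =
    N * (i%:R * N ^+ i / N * (y - x)) + N ^+ i * (y - x).
  by rewrite -natr1 exprS; field; rewrite gt_eqF.
apply: lerD.
  by apply: ler_pM => //; rewrite subr_ge0 lerXn2r ?nnegrE.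
apply: ler_wpM2r; first by rewrite subr_ge0.
by rewrite lerXn2r ?nnegrE ?(le_trans xy) // ltW.
Qed.

Definition power_sum (p n : nat) : R := \sum_(a <- iota 1 n) a%:R ^+ p.

(* The error of the trapezoidal rule on [x, x + 1] for t^p is, up to a factor,
   the sum over i of (y^i - x^i) (y^(p-i) - x^(p-i)) with y = x + 1. *)
Lemma trapezoid_expr (x y : R) (p : nat) : y - x = 1 ->
  p.+1%:R * (y ^+ p + x ^+ p) - 2 * (y ^+ p.+1 - x ^+ p.+1) =
  \sum_(i < p.+1) (y ^+ i - x ^+ i) * (y ^+ (p - i) - x ^+ (p - i)).
Proof.
move=> yx1.
have E1 : y ^+ p.+1 - x ^+ p.+1 = \sum_(i < p.+1) y ^+ (p - i) * x ^+ i.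
  by rewrite subrXX yx1 mul1r.
have E2 : y ^+ p.+1 - x ^+ p.+1 = \sum_(i < p.+1) y ^+ i * x ^+ (p - i).
  rewrite E1 (reindex_inj rev_ord_inj); apply: eq_bigr => i _ /=.
  by rewrite subSS subKn // -ltnS.
have E3 : p.+1%:R * (y ^+ p + x ^+ p) = \sum_(i < p.+1) (y ^+ p + x ^+ p).
  by rewrite sumr_const card_ord mulr_natl.
rewrite [2 * _]mulr_natl mulr2n {1}E1 E2 E3 -big_split -sumrB.
apply: eq_bigr => i _ /=.
have ip : (i <= p)%N by rewrite -ltnS.
rewrite -{1 2}(subnKC ip) !exprD; ring.
Qed.

(** Adding the trapezoidal errors over the unit intervals of [0, n] makes the main terms telescope.
    Every error is nonnegative and at most a constant times n^(p - 2). *)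
Lemma power_sum_approx (p n : nat) : (0 < p)%N -> (0 < n)%N ->
  `|p.+1%:R * power_sum p n - n%:R ^+ p.+1 - p.+1%:R / 2 * n%:R ^+ p|
    <= p.+1%:R * p%:R ^+ 2 / 2 * (n%:R ^+ p / n%:R).
Proof.
move=> p0 n0; have N0 : 0 < n%:R :> R by rewrite ltr0n.
pose D (i : nat) : R := p.+1%:R * (i.+1%:R ^+ p + i%:R ^+ p)
   - 2 * (i.+1%:R ^+ p.+1 - i%:R ^+ p.+1).
have sumD : \sum_(i < n) D i =
    2 * (p.+1%:R * power_sum p n - n%:R ^+ p.+1 - p.+1%:R / 2 * n%:R ^+ p).
  have tele (k : nat) : \sum_(i < n) (i.+1%:R ^+ k.+1 - i%:R ^+ k.+1) = n%:R ^+ k.+1 :> R.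
    rewrite -(big_mkord xpredT (fun i => i.+1%:R ^+ k.+1 - i%:R ^+ k.+1)).
    by rewrite telescope_sumr // expr0n subr0.
  rewrite /D sumrB -!mulr_sumr tele big_split /= /power_sum big_iota1.
  (* The left endpoints are the right ones without n; the endpoint 0 contributes nothing because p >
     0. *)
  have -> : \sum_(i < n) i%:R ^+ p = \sum_(i < n) i.+1%:R ^+ p - n%:R ^+ p :> R.
    by have := tele p.-1; rewrite prednK // sumrB => <-; ring.
  by field.
have Dbound (i : 'I_n) : 0 <= D i <= p.+1%:R * (p%:R * n%:R ^+ p / n%:R * (p%:R / n%:R)).
  rewrite /D trapezoid_expr -?natrB ?subSnn //.
  pose Y : R := i.+1%:R; pose X : R := i%:R; pose N : R := n%:R.
  have YX : Y - X = 1 by rewrite -natrB // subSnn.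
  have pow k : (k <= p)%N -> 0 <= Y ^+ k - X ^+ k <= p%:R / N * N ^+ k.
    move=> kp; have /andP[-> /= h] : 0 <= Y ^+ k - X ^+ k <= k%:R * N ^+ k / N * (Y - X).
      by apply: subr_expr_le; rewrite ?ler_nat.
    apply: le_trans h _; rewrite YX mulr1 mulrAC.
    apply: ler_wpM2r; first by rewrite exprn_ge0 // ltW.
    by rewrite ler_wpM2r ?invr_ge0 ?ler_nat // ltW.
  have fact (j : 'I_p.+1) :
      0 <= (Y ^+ j - X ^+ j) * (Y ^+ (p - j) - X ^+ (p - j)) <=
      p%:R * N ^+ p / N * (p%:R / N).
    have jp : (j <= p)%N by rewrite -ltnS.
    have /andP[b1 b2] := pow _ jp.
    have /andP[b3 b4] := pow _ (leq_subr j p).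
    rewrite mulr_ge0 //=; apply: le_trans (ler_pM b1 b3 b2 b4) _.
    rewrite -[Z in _ * N ^+ Z / _](subnKC jp) exprD le_eqVlt; apply/predU1P; left.
    by field; rewrite gt_eqF.
  apply/andP; split; first by apply: sumr_ge0 => j _; have /andP[] := fact j.
  rewrite -[p.+1 in leRHS]card_ord mulr_natl -sumr_const.
  by apply: ler_sum => j _; have /andP[] := fact j.
have S0 : 0 <= \sum_(i < n) D i by apply: sumr_ge0 => i _; have /andP[] := Dbound i.
have S1 : \sum_(i < n) D i <= n%:R * (p.+1%:R * (p%:R * n%:R ^+ p / n%:R * (p%:R / n%:R))).
  rewrite -[n in leRHS]card_ord mulr_natl -sumr_const card_ord.
  by apply: ler_sum => j _; have /andP[] := Dbound j.
have {}S1 : \sum_(i < n) D i <= p.+1%:R * p%:R ^+ 2 * (n%:R ^+ p / n%:R).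
  by apply: le_trans S1 _; rewrite le_eqVlt; apply/predU1P; left; field; rewrite gt_eqF.
move: S0 S1; rewrite sumD pmulr_rge0 // => S0 S1.
rewrite ger0_norm // -(ler_pM2l (_ : 0 < 2)) //; apply: le_trans S1 _.
by rewrite le_eqVlt; apply/predU1P; left; field; rewrite gt_eqF.
Qed.

(** * Moment sums and their approximation *)

Definition first_moment (p m n : nat) : R :=
  \sum_(a <- iota 1 n)
    a%:R ^+ p * word_sum (iota 1 n) m (fun w => (good n (a :: w))%:R).

(** Here m counts only the remaining cars: this is the numerator of the expectation for m + 2 cars,
    and [first_moment] the one for m + 1. *)
Definition mixed_moment (p q m n : nat) : R :=
  \sum_(a <- iota 1 n) \sum_(b <- iota 1 n)
    a%:R ^+ p * b%:R ^+ q *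
    word_sum (iota 1 n) m (fun w => (good n (a :: b :: w))%:R).

(** One factor n - k counts the preferences a beyond k. The other bounds n - a in the first moment
    and counts the preferences b beyond k in the mixed moment. *)
Definition crowding (m n : nat) : R :=
  \sum_(k < n) (n%:R - k%:R) ^+ 2 *
    word_sum (iota 1 n) m (fun w => (crowded n k w)%:R).

Lemma good_count_gap (m n a : nat) :
  0 <= good_count m n - word_sum (iota 1 n) m (fun w => (good n (a :: w))%:R)
    <= \sum_(k < n) (k < a)%N%:R *
         word_sum (iota 1 n) m (fun w => (crowded n k w)%:R).
Proof.
rewrite -word_sumB; apply/andP; split.
  rewrite (_ : 0 = word_sum (iota 1 n) m (fun=> 0 * 0)); last by rewrite word_sumZ mul0r.
  by apply: ler_word_sum => w; rewrite mul0r; have [] := good_cons_gap n a w.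
under eq_bigr do rewrite -word_sumZ.
rewrite -word_sum_sum; apply: ler_word_sum => w.
by have [] := good_cons_gap n a w.
Qed.

Lemma word_sum_crowded_ge0 (m n k : nat) :
  0 <= word_sum (iota 1 n) m (fun w => (crowded n k w)%:R) :> R.
Proof.
rewrite (_ : 0 = word_sum (iota 1 n) m (fun=> 0 * 0)); last by rewrite word_sumZ mul0r.
by apply: ler_word_sum => w; rewrite mul0r.
Qed.

Lemma sum_iota_gt (n k : nat) : (k <= n)%N ->
  \sum_(a <- iota 1 n) (k < a)%N%:R = n%:R - k%:R :> R.
Proof.
by move=> kn; rewrite (sum_iota_threshold (fun b : bool => b%:R)) // mulr0 add0r mulr1.
Qed.

(** The losses over all a add up to exactly n [good_count m n] - [good_count m.+1 n]. Weighting them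
    by n^p instead of a^p costs at most p n^(p - 1) (n - k) for each crowded threshold k < a. *)
Lemma first_moment_approx (p m n : nat) : (0 < n)%N ->
  `|first_moment p m n - (power_sum p n * good_count m n
     - n%:R ^+ p * (n%:R * good_count m n - good_count m.+1 n))|
    <= p%:R * n%:R ^+ p / n%:R * crowding m n.
Proof.
move=> n0; have N0 : 0 < n%:R :> R by rewrite ltr0n.
set W := fun a => word_sum (iota 1 n) m (fun w => (good n (a :: w))%:R) : R.
have -> : first_moment p m n - (power_sum p n * good_count m n
     - n%:R ^+ p * (n%:R * good_count m n - good_count m.+1 n)) =
   \sum_(a <- iota 1 n) (n%:R ^+ p - a%:R ^+ p) * (good_count m n - W a).
  transitivity (\sum_(a <- iota 1 n) (a%:R ^+ p * W a - a%:R ^+ p * good_count m n +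
      n%:R ^+ p * (good_count m n - W a))); last by apply: eq_bigr => a _; ring.
  rewrite big_split sumrB -mulr_suml -mulr_sumr sumrB /= big_const_seq count_predT.
  rewrite size_iota iter_addr_0 -[_ *+ n]mulr_natl /W /good_count /first_moment /power_sum /=.
  ring.
apply: le_trans (ler_norm_sum _ _ _) _.
rewrite /crowding mulr_sumr.
apply: le_trans (_ : _ <= \sum_(a <- iota 1 n) \sum_(k < n)
   (p%:R * n%:R ^+ p / n%:R * ((n%:R - k%:R) * word_sum (iota 1 n) m
     (fun w => (crowded n k w)%:R)) * (k < a)%N%:R)) _.
  rewrite big_seq [leRHS]big_seq; apply: ler_sum => a.
  rewrite mem_iota => /andP[a0 an].
  have {}an : (a <= n)%N by lia.
  have /andP[h1 h2] := good_count_gap m n a.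
  have an' : a%:R <= n%:R :> R by rewrite ler_nat.
  have /andP[h3 h4] := subr_expr_le p (ler0n _ a) an' (lexx _) N0.
  rewrite ger0_norm ?mulr_ge0 //; apply: le_trans (ler_pM h3 h1 h4 h2) _.
  rewrite mulr_sumr; apply: ler_sum => k _; rewrite -!mulrA.
  do 3 (apply: ler_wpM2l; first by rewrite ?invr_ge0 ?exprn_ge0 // ltW).
  case: (ltnP k a) => ka; last by rewrite !mul0r !mulr0.
  rewrite mul1r mulr1; apply: ler_wpM2r; first exact: word_sum_crowded_ge0.
  by rewrite lerD2l lerN2 ler_nat ltnW.
rewrite exchange_big; apply: ler_sum => k _ /=.
by rewrite -mulr_sumr sum_iota_gt ?(ltnW (ltn_ord k)) // expr2 -!mulrA [_ * (_ - _)]mulrC.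
Qed.

(** The difference sums a^p b^q times the second difference of [good_cons2_gap]; a threshold k is
    charged by the (n - k)^2 pairs beyond it. *)
Lemma mixed_moment_approx (p q m n : nat) :
  `|mixed_moment p q m n - (power_sum q n * first_moment p m n
     + power_sum p n * first_moment q m n
     - power_sum p n * power_sum q n * good_count m n)|
    <= n%:R ^+ (p + q) * crowding m n.
Proof.
set W := fun a => word_sum (iota 1 n) m (fun w => (good n (a :: w))%:R) : R.
set V := fun a b => word_sum (iota 1 n) m (fun w => (good n (a :: b :: w))%:R) : R.
have -> : mixed_moment p q m n - (power_sum q n * first_moment p m n
     + power_sum p n * first_moment q m n
     - power_sum p n * power_sum q n * good_count m n) =
  \sum_(a <- iota 1 n) \sum_(b <- iota 1 n)
    a%:R ^+ p * b%:R ^+ q * (V a b - W a - W b + good_count m n).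
  transitivity (\sum_(a <- iota 1 n)
    ((\sum_(b <- iota 1 n) a%:R ^+ p * b%:R ^+ q * V a b)
      - a%:R ^+ p * W a * power_sum q n
      - a%:R ^+ p * first_moment q m n
      + a%:R ^+ p * (power_sum q n * good_count m n))).
    rewrite big_split !sumrB -!mulr_suml /=.
    by rewrite /mixed_moment -/(power_sum p n) -/(first_moment p m n) /V; ring.
  apply: eq_bigr => a _.
  rewrite /power_sum /first_moment mulr_suml !mulr_sumr -!sumrB -big_split /=.
  by apply: eq_bigr => b _; rewrite -/(W b); ring.
apply: le_trans (ler_norm_sum _ _ _) _.
apply: le_trans (_ : _ <= \sum_(a <- iota 1 n) \sum_(b <- iota 1 n) \sum_(k < n)
   (n%:R ^+ (p + q) * word_sum (iota 1 n) m
     (fun w => (crowded n k w)%:R)) * ((k < a)%N%:R * (k < b)%N%:R)) _.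
  rewrite big_seq [leRHS]big_seq; apply: ler_sum => a.
  rewrite mem_iota => /andP[a0 an].
  apply: le_trans (ler_norm_sum _ _ _) _.
  rewrite big_seq [leRHS]big_seq; apply: ler_sum => b.
  rewrite mem_iota => /andP[b0 bn].
  rewrite normrM ger0_norm ?mulr_ge0 ?exprn_ge0 //.
  under eq_bigr do rewrite -mulrA; rewrite -mulr_sumr.
  apply: ler_pM; rewrite ?mulr_ge0 ?exprn_ge0 //.
    by rewrite exprD; apply: ler_pM; rewrite ?exprn_ge0 // lerXn2r ?nnegrE // ler_nat; lia.
  rewrite /V /W /good_count -!word_sumB -word_sumD.
  apply: le_trans (ler_norm_word_sum _ _ _) _.
  under eq_bigr => k _ do rewrite mulrC -natrM mulnb -word_sumZ.
  rewrite -word_sum_sum; apply: ler_word_sum => w; exact: good_cons2_gap.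
under eq_bigr do rewrite exchange_big; rewrite exchange_big /crowding mulr_sumr.
apply: ler_sum => k _ /=.
under eq_bigr do under eq_bigr do rewrite mulrA.
under eq_bigr do rewrite -mulr_sumr.
rewrite -mulr_suml -mulr_sumr !sum_iota_gt ?(ltnW (ltn_ord k)) //.
by rewrite le_eqVlt; apply/predU1P; left; ring.
Qed.

End Count.

(** * From tuples and expectations to word sums *)

Lemma sum_tuple_cons (V : nmodType) (T : finType) (m : nat) (F : m.+1.-tuple T -> V) :
  \sum_(t : m.+1.-tuple T) F t = \sum_(x : T) \sum_(t : m.-tuple T) F [tuple of x :: t].
Proof.
rewrite pair_big /= (reindex (fun u : T * m.-tuple T => [tuple of u.1 :: u.2])) //=.
exists (fun t => (thead t, [tuple of behead t])) => [[x t] _|t _] /=.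
  by congr pair; apply: val_inj.
by apply: val_inj; rewrite /= [in RHS](tuple_eta t).
Qed.

Lemma sum_tuple_ord (R : numDomainType) (m n : nat) (F : seq nat -> R) :
  \sum_(t : m.-tuple 'I_n.+1 | all (fun a : 'I_n.+1 => (0 < a)%N) t)
     F [seq nat_of_ord a | a <- t] = word_sum (iota 1 n) m F.
Proof.
elim: m F => [|m IH] F.
  rewrite /= (big_pred1 [tuple]) //= => t; by rewrite [t]tuple0 /= eqxx.
rewrite big_mkcond sum_tuple_cons big_ord_recl /= big1 ?add0r => [|t _ //].
rewrite big_iota1; apply: eq_bigr => i _.
by rewrite -IH [RHS]big_mkcond; apply: eq_bigr => t _ /=.
Qed.

Lemma sum_PF (R : numDomainType) (m n : nat) (F : seq nat -> R) :
  \sum_(t in PF m n) F [seq nat_of_ord a | a <- t] =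
  word_sum (iota 1 n) m (fun w => (good n w)%:R * F w).
Proof.
rewrite -sum_tuple_ord [RHS]big_mkcond [LHS]big_mkcond /=; apply: eq_bigr => t _.
rewrite inE; case/boolP: (all _ _) => //= tpos.
rewrite parks_good //=.
  by case: good; rewrite ?mul1r ?mul0r.
by apply/allP => x /mapP[a /(allP tpos) /= a0 ->]; rewrite a0 -ltnS ltn_ord.
Qed.

Lemma card_PF (R : numFieldType) (m n : nat) : #|PF m n|%:R = good_count R m n.
Proof.
rewrite -sumr_const (sum_PF _ _ (fun=> 1)).
by apply: eq_word_sum => w _ _; rewrite mulr1.
Qed.

Lemma first_moment_PF (R : numFieldType) (p m n : nat) :
  uniform_expectation (PF m.+1 n) (fun pi => (car pi 1)%:R ^+ p) =
  first_moment R p m n / good_count R m.+1 n.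
Proof.
rewrite /uniform_expectation card_PF; congr (_ / _).
rewrite (eq_bigr (fun t : m.+1.-tuple 'I_n.+1 =>
   (fun w => (nth 0%N w 0)%:R ^+ p) [seq nat_of_ord a | a <- t] : R)); last first.
  by move=> t _; rewrite /car /= (nth_map ord0) // size_tuple.
rewrite (sum_PF _ _ (fun w => (nth 0%N w 0)%:R ^+ p)) /=.
apply: eq_bigr => a _; rewrite -word_sumZ.
by apply: eq_word_sum => w _ _; rewrite mulrC.
Qed.

Lemma mixed_moment_PF (R : numFieldType) (p q m n : nat) :
  uniform_expectation (PF m.+2 n)
    (fun pi => (car pi 1)%:R ^+ p * (car pi 2)%:R ^+ q) =
  mixed_moment R p q m n / good_count R m.+2 n.
Proof.
rewrite /uniform_expectation card_PF; congr (_ / _).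
rewrite (eq_bigr (fun t : m.+2.-tuple 'I_n.+1 =>
   (fun w => (nth 0%N w 0)%:R ^+ p * (nth 0%N w 1)%:R ^+ q)
     [seq nat_of_ord a | a <- t] : R)); last first.
  by move=> t _; rewrite /car /= !(nth_map ord0) // size_tuple.
rewrite (sum_PF _ _ (fun w => (nth 0%N w 0)%:R ^+ p * (nth 0%N w 1)%:R ^+ q)) /=.
apply: eq_bigr => a _; apply: eq_bigr => b _; rewrite -word_sumZ.
by apply: eq_word_sum => w _ _; rewrite mulrC.
Qed.

(** * Exponential bound on crowding *)

Lemma sum_sqr_geometric_le (R : realFieldType) (r : R) : 0 <= r < 1 ->
  exists C : R, forall n, \sum_(l < n) l.+1%:R ^+ 2 * r ^+ l.+1 <= C.
Proof.
case/andP=> r0 r1; have d0 : 0 < 1 - r by rewrite subr_gt0.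
(* The coefficients solve V(l) - V(l + 1) = l^2 r^l, so the sum telescopes; V is nonnegative. *)
pose al := 1 / (1 - r); pose be := 2 * r * al / (1 - r).
pose ga := (r * al + r * be) / (1 - r).
pose V (l : nat) := (al * l%:R ^+ 2 + be * l%:R + ga) * r ^+ l.
have d1 := ltW d0.
have al0 : 0 <= al by apply: divr_ge0.
have be0 : 0 <= be by apply: divr_ge0 => //; do 2!apply: mulr_ge0 => //.
have ga0 : 0 <= ga by apply: divr_ge0 => //; apply: addr_ge0; apply: mulr_ge0.
exists (V 1%N) => n.
have -> : \sum_(l < n) l.+1%:R ^+ 2 * r ^+ l.+1 = V 1%N - V n.+1.
  elim: n => [|n IH]; first by rewrite big_ord0 subrr.
  rewrite big_ord_recr /= IH /V /ga /be /al -[n.+2%:R]natr1 (exprS r n.+1).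
  by field; rewrite gt_eqF.
rewrite gerBl /V; apply: mulr_ge0; last exact: exprn_ge0.
by apply: addr_ge0 => //; apply: addr_ge0; apply: mulr_ge0 => //; exact: exprn_ge0.
Qed.

(* Chernoff bound with base [c^-1]: at most [c * (n - k)] of the letters are
   expected to exceed [k]. *)
Lemma word_sum_crowded_le (R : realType) (c : R) (m n k : nat) :
  0 < c -> c < 1 -> m%:R <= c * n%:R -> (k < n)%N ->
  word_sum (iota 1 n) m (fun w => (crowded n k w)%:R)
    <= c^-1 * (c * expR (1 - c)) ^+ (n - k) * n%:R ^+ m.
Proof.
move=> c0 c1 mcn kn; set l := (n - k)%N.
have N0 : 0 < n%:R :> R by rewrite ltr0n (leq_ltn_trans _ kn).
have x1 : 1 <= c^-1 by rewrite invf_ge1 // ltW.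
(* A crowded word has at least l - 1 letters beyond k, so its weight on the right is at least 1. *)
apply: le_trans (_ : _ <= word_sum (iota 1 n) m
   (fun w => c^-1 * c ^+ l * (c^-1) ^+ count (ltn k) w)) _.
  apply: ler_word_sum => w; rewrite /crowded -/l; case: leqP => lw; last first.
    by rewrite !mulr_ge0 ?exprn_ge0 ?invr_ge0 // ltW.
  rewrite mulrAC -exprS -(@ler_pM2l _ (c^-1 ^+ l)) ?exprn_gt0 ?invr_gt0 // mulr1.
  rewrite mulrCA -exprMn mulVf ?gt_eqF // expr1n mulr1.
  exact: ler_weXn2l.
rewrite word_sumZ word_sum_expr_count -!mulrA ler_pM2l ?invr_gt0 //.
rewrite exprMn -mulrA ler_pM2l ?exprn_gt0 //.
rewrite (sum_iota_threshold (fun b : bool => c^-1 ^+ b)) ?(ltnW kn) // expr0 expr1.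
have -> : k%:R * 1 + (n%:R - k%:R) / c = n%:R * (1 + (c^-1 - 1) * l%:R / n%:R).
  by rewrite /l natrB ?(ltnW kn) //; field; rewrite !gt_eqF.
rewrite exprMn mulrC; apply: ler_wpM2r; first by rewrite exprn_ge0 // ltW.
set y := (c^-1 - 1) * l%:R / n%:R.
have y0 : 0 <= y by rewrite divr_ge0 ?mulr_ge0 ?subr_ge0 // ltW.
(* By 1 + y <= e^y and m <= c n the power is at most e^(c n y), and c n y = (1 - c) l. *)
apply: le_trans (_ : _ <= expR y ^+ m) _.
  by rewrite lerXn2r ?nnegrE ?addr_ge0 ?expR_ge0 // expR_ge1Dx.
rewrite -!expRM_natl ler_expR.
apply: le_trans (ler_wpM2r y0 mcn) _.
rewrite le_eqVlt; apply/predU1P; left; rewrite /y.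
by field; rewrite !gt_eqF.
Qed.

Lemma crowding_le (R : realType) (c : R) : 0 < c -> c < 1 ->
  exists2 C : R, 0 <= C & forall m n, m%:R <= c * n%:R ->
    crowding R m n <= C * n%:R ^+ m.
Proof.
move=> c0 c1; pose r := c * expR (1 - c).
have r0 : 0 <= r by rewrite mulr_ge0 ?expR_ge0 // ltW.
have r1 : r < 1.
  (* The strict inequality 1 + x < e^x at x = c - 1 gives c < e^(c - 1). *)
  have := @expR_gt1Dx _ (c - 1); rewrite subr_eq0 lt_eqF // addrC subrK => /(_ isT).
  by rewrite -ltr_pdivlMr ?expR_gt0 // div1r -expRN opprB.
have [|C HC] := @sum_sqr_geometric_le _ r; first by rewrite r0.
have C0 : 0 <= C by have := HC 0%N; rewrite big_ord0.
exists (c^-1 * C) => [|m n mcn]; first by rewrite mulr_ge0 ?invr_ge0 // ltW.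
apply: le_trans (_ : _ <= \sum_(k < n) c^-1 * n%:R ^+ m *
   ((n - k)%:R ^+ 2 * r ^+ (n - k))) _.
  apply: ler_sum => k _; rewrite natrB ?(ltnW (ltn_ord k)) //.
  have -> (x y : R) : c^-1 * n%:R ^+ m * (x * y) = x * (c^-1 * y * n%:R ^+ m) by ring.
  by apply: ler_wpM2l; [exact: sqr_ge0 | exact: word_sum_crowded_le].
rewrite -mulr_sumr [leRHS]mulrAC; apply: ler_wpM2l.
  by rewrite mulr_ge0 ?exprn_ge0 ?invr_ge0 // ltW.
apply: le_trans (HC n); rewrite (reindex_inj rev_ord_inj) /=.
by apply: ler_sum => k _; rewrite subKn.
Qed.

(** * Calculus of expansions up to O(1 / n^2) *)

Section Expansion.
Variables (R : realType) (c : R) (k : nat).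
Hypotheses (c0 : 0 < c) (c1 : c < 1) (k0 : (0 < k)%N).

(** One constant serves all n, not only large n, so the rules below need no limit argument. The
    bound k <= m keeps m - j untruncated for j <= k. *)
Definition expansion (f : nat -> nat -> R) (a b : R) : Prop :=
  exists2 K : R, 0 <= K & forall m n, (k <= m)%N -> m%:R = c * n%:R ->
    `|f m n - (a + b / n%:R)| <= K / n%:R ^+ 2.

Lemma proportional_gt0 (m n : nat) : (k <= m)%N -> m%:R = c * n%:R -> (0 < n)%N.
Proof.
move=> km mcn; case: n mcn => // /eqP.
by rewrite mulr0 pnatr_eq0 => /eqP m0; move: km; rewrite m0 leqNgt k0.
Qed.

Lemma eq_expansion f g a b a' b' :
  (forall m n, (k <= m)%N -> m%:R = c * n%:R -> f m n = g m n) ->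
  a = a' -> b = b' -> expansion f a b -> expansion g a' b'.
Proof.
by move=> fg <- <- [K K0 HK]; exists K => // m n km mcn; rewrite -fg //; exact: HK.
Qed.

Lemma expansion_cst a : expansion (fun _ _ => a) a 0.
Proof. by exists 0 => // m n _ _; rewrite mul0r addr0 subrr normr0 mul0r. Qed.

Lemma expansion_error f K : 0 <= K ->
  (forall m n, (k <= m)%N -> m%:R = c * n%:R -> `|f m n| <= K / n%:R ^+ 2) ->
  expansion f 0 0.
Proof. by move=> K0 HK; exists K => // m n km mcn; rewrite mul0r addr0 subr0 HK. Qed.

Lemma expansionD f g a b a' b' : expansion f a b -> expansion g a' b' ->
  expansion (fun m n => f m n + g m n) (a + a') (b + b').
Proof.
move=> [K K0 HK] [L L0 HL]; exists (K + L) => [|m n km mcn]; first exact: addr_ge0.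
have -> : f m n + g m n - (a + a' + (b + b') / n%:R) =
  (f m n - (a + b / n%:R)) + (g m n - (a' + b' / n%:R)) by ring.
by rewrite (le_trans (ler_normD _ _)) // mulrDl lerD ?HK ?HL.
Qed.

Lemma expansionM f g a b a' b' : expansion f a b -> expansion g a' b' ->
  expansion (fun m n => f m n * g m n) (a * a') (a * b' + b * a').
Proof.
move=> [K K0 HK] [L L0 HL].
(* The terms bound b b' / n^2, the error of f times g, and a + b / n times the error of g, using n
   >= 1. *)
exists (`|b| * `|b'| + K * (`|a'| + `|b'| + L) + (`|a| + `|b|) * L) => [|m n km mcn].
  by do !(apply: addr_ge0 || apply: mulr_ge0) => //.
have n0 := proportional_gt0 km mcn.
have N0 : 0 < n%:R :> R by rewrite ltr0n.
have N1 : n%:R^-1 <= 1 :> R by rewrite invf_le1 // ler1n.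
have {}HK := HK m n km mcn; have {}HL := HL m n km mcn.
set e := f m n - _ in HK; set d := g m n - _ in HL.
have z0 : 0 <= n%:R^-1 :> R by rewrite invr_ge0 ltW.
have lin (x y : R) : `|x + y / n%:R| <= `|x| + `|y|.
  apply: le_trans (ler_normD _ _) _; rewrite lerD2l normrM (ger0_norm z0).
  by rewrite ler_piMr.
have d2 : `|g m n| <= `|a'| + `|b'| + L.
  have -> : g m n = (a' + b' / n%:R) + d by rewrite /d; ring.
  apply: le_trans (ler_normD _ _) _; apply: lerD => //; apply: le_trans HL _.
  by rewrite ler_piMr // -exprVn exprn_ile1.
have -> : f m n * g m n - (a * a' + (a * b' + b * a') / n%:R) =
  b * b' / n%:R ^+ 2 + e * g m n + (a + b / n%:R) * d.
  by rewrite /e /d; field; rewrite gt_eqF.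
have q0 : 0 <= (n%:R ^+ 2)^-1 :> R by rewrite invr_ge0 exprn_ge0 // ltW.
rewrite [leRHS]mulrDl; apply: le_trans (ler_normD _ _) _; apply: lerD.
  rewrite [leRHS]mulrDl; apply: le_trans (ler_normD _ _) _; apply: lerD.
    by rewrite !normrM (ger0_norm q0).
  by rewrite normrM mulrAC; apply: ler_pM.
by rewrite normrM -mulrA; apply: ler_pM.
Qed.

Lemma expansionZ x f a b : expansion f a b ->
  expansion (fun m n => x * f m n) (x * a) (x * b).
Proof.
move=> H; have := expansionM (expansion_cst x) H.
by apply: eq_expansion => //; rewrite mul0r addr0.
Qed.

Lemma expansionX f b (j : nat) : expansion f 1 b ->
  expansion (fun m n => f m n ^+ j) 1 (j%:R * b).
Proof.
move=> H; elim: j => [|j IH].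
  by apply: eq_expansion (expansion_cst 1) => //; rewrite mul0r.
apply: eq_expansion (expansionM H IH) => [m n _ _||]; first by rewrite exprS.
  by rewrite mul1r.
by rewrite -natr1; ring.
Qed.

Lemma expansion_ratio_succ : expansion (fun _ n => n%:R / n.+1%:R) 1 (-1).
Proof.
exists 1 => // m n km mcn; have n0 := proportional_gt0 km mcn.
have N0 : 0 < n%:R :> R by rewrite ltr0n.
have -> : n%:R / n.+1%:R - (1 + -1 / n%:R) = 1 / (n%:R * n.+1%:R) :> R.
  have N1 : 0 < n%:R + 1 :> R by rewrite addr_gt0.
  by rewrite -natr1; field; rewrite !gt_eqF.
rewrite ger0_norm ?divr_ge0 // ler_wpM2l // lef_pV2 ?posrE ?exprn_gt0 ?mulr_gt0 //.
by rewrite expr2 ler_wpM2l // ler_nat.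
Qed.

(** For m = c n the denominator is n + 1 - m, a factor of the exact count. *)
Lemma expansion_inv_free :
  expansion (fun m n => ((1 - c) * n%:R + 1)^-1) 0 (1 - c)^-1.
Proof.
have d0 : 0 < 1 - c by rewrite subr_gt0.
exists ((1 - c) ^- 2) => [|m n km mcn]; first by rewrite invr_ge0 exprn_ge0 // ltW.
have n0 := proportional_gt0 km mcn.
have N0 : 0 < n%:R :> R by rewrite ltr0n.
have D0 : 0 < (1 - c) * n%:R by rewrite mulr_gt0.
have D1 : 0 < (1 - c) * n%:R + 1 by rewrite addr_gt0.
have -> : ((1 - c) * n%:R + 1)^-1 - (0 + (1 - c)^-1 / n%:R) =
   - (((1 - c) * n%:R) * ((1 - c) * n%:R + 1))^-1.
  by field; rewrite !gt_eqF.
rewrite normrN ger0_norm; last by rewrite invr_ge0 mulr_ge0 // ltW.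
rewrite -[leRHS]invfM -exprMn lef_pV2 ?posrE ?exprn_gt0 ?mulr_gt0 // expr2.
by rewrite ler_wpM2l ?lerDl // ltW.
Qed.

(** The error has to depend on n alone: m is recovered as the integer part of c n, and the error is
    0 where c n is not an integer at least k. *)
Lemma expansion_bigO f b : expansion f 1 b ->
  exists eps : nat -> R,
    eps =O_\oo (fun n : nat => 1 / n%:R ^+ 2 : R) /\
    forall m n, (k <= m)%N -> m%:R = c * n%:R ->
      f m n = 1 + 1 / n%:R * b + eps n.
Proof.
move=> [K K0 HK].
pose M (n : nat) := Num.truncn (c * n%:R).
exists (fun n => if (k <= M n)%N && ((M n)%:R == c * n%:R)
                 then f (M n) n - (1 + b / n%:R) else 0); split; last first.
  move=> m n km mcn; have ME : M n = m by rewrite /M -mcn natrK.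
  by rewrite ME km mcn eqxx /=; ring.
apply/eqO_exP; exists (K + 1); first by rewrite ltr_wpDl.
near=> n.
have le0 : 0 <= 1 / n%:R ^+ 2 :> R by rewrite divr_ge0.
case: ifP => [/andP[km /eqP mcn]|_]; last by rewrite normr0 mulr_ge0 // addr_ge0.
apply: le_trans (HK _ _ km mcn) _; rewrite (ger0_norm le0) div1r.
by apply: ler_wpM2r; rewrite ?lerDl // -div1r.
Unshelve. all: by end_near.
Qed.

End Expansion.

(** * Expansions of the counts and of the moments *)

Section Moments.
Variables (R : realType) (c : R) (k : nat).
Hypotheses (c0 : 0 < c) (c1 : c < 1) (k0 : (0 < k)%N).

Lemma proportional_lt (m n : nat) : (k <= m)%N -> m%:R = c * n%:R -> (m < n)%N.
Proof.
move=> km mcn; have n0 := proportional_gt0 k0 km mcn.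
by rewrite -(ltr_nat R) mcn gtr_pMl // ltr0n.
Qed.

Lemma good_count_eq (m n : nat) : (m <= n.+1)%N ->
  good_count R m n = (n.+1%:R - m%:R) * n.+1%:R ^+ m / n.+1%:R.
Proof.
move=> mn; rewrite -good_countE // mulrC mulKf // pnatr_eq0.
Qed.

(** The exact count is (n + 1 - m) (n + 1)^(m - 1). As good words are a fixed proportion of all
    words, bounds relative to n^m carry over to the uniform law on good ones. *)
Lemma good_count_ge (m n : nat) : (k <= m)%N -> m%:R = c * n%:R ->
  (1 - c) * n%:R ^+ m <= good_count R m n.
Proof.
move=> km mcn; have mn := proportional_lt km mcn.
have m0 : (0 < m)%N := leq_trans k0 km.
have E x : x ^+ m = x * x ^+ m.-1 :> R by rewrite -exprS prednK.
rewrite good_count_eq ?(leqW (ltnW mn)) // !E mulrA.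
rewrite [leRHS](_ : _ = (n.+1%:R - m%:R) * n.+1%:R ^+ m.-1); last first.
  by field; rewrite addrC natr1 pnatr_eq0.
apply: ler_pM; rewrite ?exprn_ge0 //.
- by rewrite mulr_ge0 // subr_ge0 ltW.
- by rewrite mcn -natr1 mulrBl mul1r addrAC lerDl.
by rewrite lerXn2r ?nnegrE // ler_nat.
Qed.

Lemma good_count_gt0 (m n : nat) : (k <= m)%N -> m%:R = c * n%:R ->
  0 < good_count R m n.
Proof.
move=> km mcn; apply: lt_le_trans (good_count_ge km mcn).
by rewrite mulr_gt0 ?subr_gt0 // exprn_gt0 // ltr0n (proportional_gt0 k0 km mcn).
Qed.

(** By the exact count the ratio is (n / (n + 1))^j (1 + j / (n + 1 - m)), and - j + j / (1 - c) = j
    c / (1 - c). *)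
Lemma expansion_good_count (j : nat) : (j <= k)%N ->
  expansion c k (fun m n => n%:R ^+ j * good_count R (m - j) n / good_count R m n)
    1 (j%:R * (c / (1 - c))).
Proof.
move=> jk; have d0 : 0 < 1 - c by rewrite subr_gt0.
have H := expansionM k0 (expansionX k0 j (expansion_ratio_succ c k0))
  (expansionD (expansion_cst c k 1) (expansionZ k0 j%:R (expansion_inv_free c1 k0))).
apply: eq_expansion H => [m n km mcn||]; last 2 first.
- by rewrite mulr0 addr0 mulr1.
- by field; rewrite !lt0r_neq0 ?exprn_gt0.
have n0 := proportional_gt0 k0 km mcn.
have mn := proportional_lt km mcn.
have jm := leq_trans jk km.
have N0 : 0 < n%:R :> R by rewrite ltr0n.
rewrite !good_count_eq; [|lia|lia].
have E : n.+1%:R ^+ m = n.+1%:R ^+ (m - j) * n.+1%:R ^+ j :> R by rewrite -exprD subnK.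
rewrite E natrB // expr_div_n mcn -natr1.
have D1 : 0 < (1 - c) * n%:R + 1 by rewrite addr_gt0 // mulr_gt0.
have S0 : 0 < n%:R + 1 :> R by rewrite addr_gt0.
field; rewrite !(gt_eqF, expf_neq0) //=.
by rewrite (_ : n%:R + 1 - c * n%:R = (1 - c) * n%:R + 1) ?gt_eqF //; ring.
Qed.

Lemma expansion_power_sum (p : nat) : (0 < p)%N ->
  expansion c k (fun _ n => p.+1%:R * power_sum R p n / n%:R ^+ p.+1)
    1 (p.+1%:R / 2).
Proof.
move=> p0; exists (p.+1%:R * p%:R ^+ 2 / 2) => [|m n km mcn].
  by rewrite divr_ge0 ?mulr_ge0 ?exprn_ge0.
have n0 := proportional_gt0 k0 km mcn.
have N0 : 0 < n%:R :> R by rewrite ltr0n.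
have Np : 0 < n%:R ^+ p.+1 :> R by rewrite exprn_gt0.
have -> : p.+1%:R * power_sum R p n / n%:R ^+ p.+1 - (1 + p.+1%:R / 2 / n%:R) =
   (p.+1%:R * power_sum R p n - n%:R ^+ p.+1 - p.+1%:R / 2 * n%:R ^+ p) / n%:R ^+ p.+1.
  by rewrite exprS; field; rewrite !lt0r_neq0 ?exprn_gt0.
rewrite normrM (gtr0_norm (_ : 0 < _^-1)) ?invr_gt0 // ler_pdivrMr //.
apply: le_trans (power_sum_approx R p0 n0) _.
rewrite [_ ^+ p.+1]exprS le_eqVlt; apply/predU1P; left.
by field; rewrite !lt0r_neq0 ?exprn_gt0.
Qed.

(** Crowding by m - j cars is O(n^(m - j)), against at least (1 - c) n^m good words of m cars. *)
Lemma crowding_ratio : exists2 C : R, 0 <= C &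
  forall j m n, (j <= k)%N -> (k <= m)%N -> m%:R = c * n%:R ->
    crowding R (m - j) n / good_count R m n <= C / n%:R ^+ j.
Proof.
have d0 : 0 < 1 - c by rewrite subr_gt0.
have [C C0 HC] := crowding_le c0 c1.
exists (C / (1 - c)) => [|j m n jk km mcn]; first by rewrite divr_ge0 // ltW.
have n0 := proportional_gt0 k0 km mcn.
have N0 : 0 < n%:R :> R by rewrite ltr0n.
have jm := leq_trans jk km.
rewrite ler_pdivrMr ?good_count_gt0 //.
apply: le_trans (HC _ _ _) _; first by rewrite -mcn ler_nat leq_subr.
apply: le_trans (_ : _ <= C / (1 - c) / n%:R ^+ j * ((1 - c) * n%:R ^+ m)) _.
  have -> : n%:R ^+ m = n%:R ^+ (m - j) * n%:R ^+ j :> R by rewrite -exprD subnK.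
  rewrite le_eqVlt; apply/predU1P; left.
  by field; rewrite !lt0r_neq0 ?exprn_gt0.
apply: ler_wpM2l; last exact: good_count_ge.
by rewrite !divr_ge0 ?exprn_ge0 // ltW.
Qed.


(** The sum involves m - j cars but is normalised by the count for m. The first expectation uses j =
    0, the mixed moment j = 1. *)
Lemma expansion_first_moment (p j : nat) : (0 < p)%N -> (j < k)%N ->
  expansion c k (fun m n => p.+1%:R * n%:R ^+ j * first_moment R p (m - j.+1) n /
                            (n%:R ^+ p * good_count R m n))
    1 (p.+1%:R / 2 + (j%:R - p%:R) * (c / (1 - c))).
Proof.
move=> p0 jk.
have [C C0 HC] := crowding_ratio.
pose rho i m n : R := n%:R ^+ i * good_count R (m - i) n / good_count R m n.
pose s n : R := p.+1%:R * power_sum R p n / n%:R ^+ p.+1.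
(* The main term of [first_moment_approx] after normalisation; the bracket is the number of lost
   preferences. *)
pose main m n : R := s n * rho j.+1 m n + - p.+1%:R * (rho j.+1 m n + - 1 * rho j m n).
have Hs := expansion_power_sum p0.
have H1 := expansion_good_count jk.
have H0 := expansion_good_count (ltnW jk).
have Hmain : expansion c k main 1 (p.+1%:R / 2 + (j%:R - p%:R) * (c / (1 - c))).
  have := expansionD (expansionM k0 Hs H1)
    (expansionZ k0 (- p.+1%:R) (expansionD H1 (expansionZ k0 (- 1) H0))).
  apply: eq_expansion => //; first by ring.
  by rewrite -!natr1; ring.
pose X m n : R := p.+1%:R * n%:R ^+ j * first_moment R p (m - j.+1) n /
                  (n%:R ^+ p * good_count R m n).
have Herr : expansion c k (fun m n => X m n - main m n) 0 0.
  apply: (@expansion_error _ _ _ _ (p.+1%:R * p%:R * C)) => [|m n km mcn].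
    by rewrite !mulr_ge0.
  have n0 := proportional_gt0 k0 km mcn.
  have N0 : 0 < n%:R :> R by rewrite ltr0n.
  have jm := leq_trans jk km.
  have G0 := good_count_gt0 km mcn.
  have := first_moment_approx R p (m - j.+1) n0.
  (* The m - (j + 1) remaining cars and the one in front make m - j. *)
  rewrite -subSn // subSS; set D := _ - _ => HD.
  have -> : X m n - main m n = p.+1%:R * n%:R ^+ j / n%:R ^+ p / good_count R m n * D.
    rewrite /X /main /s /rho /D !exprS.
    by field; rewrite !lt0r_neq0 ?exprn_gt0.
  rewrite normrM ger0_norm; last by rewrite !divr_ge0 ?mulr_ge0 ?exprn_ge0 ?ltW.
  apply: le_trans (ler_wpM2l _ HD) _.
    by rewrite !divr_ge0 ?mulr_ge0 ?exprn_ge0 ?ltW.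
  rewrite [leLHS](_ : _ = p.+1%:R * p%:R * (n%:R ^+ j / n%:R) *
     (crowding R (m - j.+1) n / good_count R m n)); last first.
    by field; rewrite !lt0r_neq0 ?exprn_gt0.
  rewrite [leRHS](_ : _ = p.+1%:R * p%:R * (n%:R ^+ j / n%:R) *
     (C / n%:R ^+ j.+1)); last first.
    by rewrite [_ ^+ j.+1]exprS; field; rewrite !lt0r_neq0 ?exprn_gt0.
  apply: ler_wpM2l; last exact: HC.
  by rewrite !mulr_ge0 ?exprn_ge0 ?invr_ge0.
have := expansionD Hmain Herr.
apply: eq_expansion => [m n _ _||]; rewrite ?addr0 //.
by rewrite addrC subrK.
Qed.

(** The three main terms contribute (1 - p) + (1 - q) - 2 = - (p + q) times c / (1 - c). The error
    is crowding by m - 2 cars, hence O(1 / n^2) at once. *)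
Lemma expansion_mixed_moment (p q : nat) : (0 < p)%N -> (0 < q)%N -> (1 < k)%N ->
  expansion c k (fun m n => p.+1%:R * q.+1%:R * mixed_moment R p q (m - 2) n /
                            (n%:R ^+ (p + q) * good_count R m n))
    1 ((p%:R + q%:R + 2) / 2 - (p%:R + q%:R) * (c / (1 - c))).
Proof.
move=> p0 q0 k1.
have [C C0 HC] := crowding_ratio.
pose rho m n : R := n%:R ^+ 2 * good_count R (m - 2) n / good_count R m n.
pose s r n : R := r.+1%:R * power_sum R r n / n%:R ^+ r.+1.
pose xi r m n : R := r.+1%:R * n%:R ^+ 1 * first_moment R r (m - 2) n /
                     (n%:R ^+ r * good_count R m n).
pose main m n : R := s q n * xi p m n + s p n * xi q m n
                     + - 1 * (s p n * s q n * rho m n).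
have Hp := expansion_power_sum p0.
have Hq := expansion_power_sum q0.
have Xp := expansion_first_moment p0 k1.
have Xq := expansion_first_moment q0 k1.
have H2 := expansion_good_count k1.
have Hmain : expansion c k main 1
    ((p%:R + q%:R + 2) / 2 - (p%:R + q%:R) * (c / (1 - c))).
  have := expansionD (expansionD (expansionM k0 Hq Xp) (expansionM k0 Hp Xq))
    (expansionZ k0 (- 1) (expansionM k0 (expansionM k0 Hp Hq) H2)).
  apply: eq_expansion => //; first by ring.
  by rewrite -!natr1; field; rewrite gt_eqF // subr_gt0.
pose X m n : R := p.+1%:R * q.+1%:R * mixed_moment R p q (m - 2) n /
                  (n%:R ^+ (p + q) * good_count R m n).
have Herr : expansion c k (fun m n => X m n - main m n) 0 0.
  apply: (@expansion_error _ _ _ _ (p.+1%:R * q.+1%:R * C)) => [|m n km mcn].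
    by rewrite !mulr_ge0.
  have n0 := proportional_gt0 k0 km mcn.
  have N0 : 0 < n%:R :> R by rewrite ltr0n.
  have G0 := good_count_gt0 km mcn.
  have := mixed_moment_approx R p q (m - 2) n.
  set D := _ - _ => HD.
  have -> : X m n - main m n =
      p.+1%:R * q.+1%:R / n%:R ^+ (p + q) / good_count R m n * D.
    rewrite /X /main /s /rho /xi /D !exprS exprD.
    by field; rewrite !lt0r_neq0 ?exprn_gt0.
  rewrite normrM ger0_norm; last by rewrite !divr_ge0 ?mulr_ge0 ?exprn_ge0 ?ltW.
  apply: le_trans (ler_wpM2l _ HD) _.
    by rewrite !divr_ge0 ?mulr_ge0 ?exprn_ge0 ?ltW.
  rewrite [leLHS](_ : _ = p.+1%:R * q.+1%:R *
     (crowding R (m - 2) n / good_count R m n)); last first.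
    by field; rewrite !lt0r_neq0 ?exprn_gt0.
  by rewrite -[leRHS]mulrA ler_wpM2l ?mulr_ge0 // HC.
have := expansionD Hmain Herr.
apply: eq_expansion => [m n _ _||]; rewrite ?addr0 //.
by rewrite addrC subrK.
Qed.

End Moments.

Theorem theorem3p1 (R : realType) (p q : nat) (c : R)
    (hp : (1 <= p)%N) (hq : (1 <= q)%N) (hc0 : 0 < c) (hc1 : c < 1) :
  (exists eps : nat -> R,
     eps =O_\oo (fun n : nat => 1 / n%:R ^+ 2 : R) /\
     forall m n : nat, (1 <= m)%N -> m%:R = c * n%:R ->
       uniform_expectation (PF m n) (fun pi => (car pi 1)%:R ^+ p) =
       n%:R ^+ p / (p%:R + 1) *
         (1 + 1 / n%:R * ((p%:R + 1) / 2 - c * p%:R / (1 - c)) + eps n))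
  /\
  (exists eps : nat -> R,
     eps =O_\oo (fun n : nat => 1 / n%:R ^+ 2 : R) /\
     forall m n : nat, (2 <= m)%N -> m%:R = c * n%:R ->
       uniform_expectation (PF m n)
         (fun pi => (car pi 1)%:R ^+ p * (car pi 2)%:R ^+ q) =
       n%:R ^+ (p + q) / ((p%:R + 1) * (q%:R + 1)) *
         (1 + 1 / n%:R * ((p%:R + q%:R + 2) / 2 - c * (p%:R + q%:R) / (1 - c))
            + eps n)).
Proof.
split.
  (* One car is singled out and none is left out: k = 1 and j = 0. *)
  have [eps [Oeps E]] :=
    expansion_bigO (expansion_first_moment hc0 hc1 (ltn0Sn 0) hp (ltn0Sn 0)).
  exists eps; split=> // m n m1 mcn.
  have n0 := proportional_gt0 (ltn0Sn 0) m1 mcn.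
  have N0 : 0 < n%:R :> R by rewrite ltr0n.
  have G0 := good_count_gt0 hc1 (ltn0Sn 0) m1 mcn.
  have -> : (p%:R + 1) / 2 - c * p%:R / (1 - c) =
            p.+1%:R / 2 + (0 - p%:R) * (c / (1 - c)) by rewrite -natr1; ring.
  rewrite -(E m n) //; case: m m1 mcn G0 {E} => // m _ mcn G0.
  rewrite first_moment_PF subn1 /= natr1.
  by field; rewrite !lt0r_neq0 ?exprn_gt0 ?ltr_wpDr.
have [eps [Oeps E]] :=
  expansion_bigO (expansion_mixed_moment hc0 hc1 (ltn0Sn 1) hp hq (ltnSn 1)).
exists eps; split=> // m n m1 mcn.
have n0 := proportional_gt0 (ltn0Sn 1) m1 mcn.
have N0 : 0 < n%:R :> R by rewrite ltr0n.
have G0 := good_count_gt0 hc1 (ltn0Sn 1) m1 mcn.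
rewrite [c * (_ + _) / _]mulrAC [c / _ * _]mulrC -(E m n) //.
case: m m1 mcn G0 {E} => [|[|m]] // _ mcn G0.
rewrite mixed_moment_PF subn2 /= !natr1.
by field; rewrite !lt0r_neq0 ?exprn_gt0 ?ltr_wpDr.
Qed.
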